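(* Let $d\ge1$, let $\mathbf w_0,\dots,\mathbf w_d\in\mathbb F_2^d$, and let $\mathcal P=\{P_1,\dots,P_k\}$ be a partition of $\{1,\dots,d\}$ into $k$ disjoint non-empty sets. If $$\sum_{i=0}^d\alpha(\mathbf w_i,\mathcal P)<d+k,$$ then $F_{\mathbf w_0}\cdots F_{\mathbf w_d}=0$ in the Chow ring $\mathrm{Chow}_{\mathrm{GS}}(\square^d)$.
   Context: For $\mathbf w\in\mathbb F_2^d$, $\alpha(\mathbf w,\mathcal P)$ is the number of indices $1\le l\le k$ such that there exists $j\in P_l$ for which the $j$-th coordinate of $\mathbf w$ equals $1$. $\square^d=\{0,1\}^d$ is identified with $\mathbb F_2^d$ and ordered coordinatewise ($0<1$); (possibly repeated) vertices form a simplex iff they are pairwise comparable. $\mathrm{Chow}_{\mathrm{GS}}(\square^d)$ is the quotient of $\mathbb Z[C_{\mathbf v}\mid\mathbf v\in\square^d]$ by the ideal generated by: (R1) $C_{\mathbf v_1}\cdots C_{\mathbf v_m}$ whenever $\mathbf v_1,\dots,\mathbf v_m$ do not form a simplex; (R2) $C_{\mathbf u}\sum_{\mathbf v\in\square^d}C_{\mathbf v}$ for $\mathbf u\in\square^d$; (R3) $C_{\mathbf u}C_{\mathbf w}\sum_{\mathbf v\in\square^d:\,v_i=u_i}C_{\mathbf v}$ for $\mathbf u,\mathbf w\in\square^d$ and $1\le i\le d$ with $u_i\neq w_i$. For $\mathbf w\in\mathbb F_2^d$, $F_{\mathbf w}=\sum_{\mathbf v\in\square^d}(-1)^{\langle\mathbf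 v,\mathbf w\rangle}C_{\mathbf v}$, where $\langle\mathbf v,\mathbf w\rangle=\sum_{i=1}^d v_iw_i\in\mathbb F_2$. *)

(* Defs.v *)
From HB Require Import structures.
From mathcomp Require Import all_boot all_order all_algebra.
From mathcomp Require Import boolp.
From mathcomp Require Import mpoly.

Set Implicit Arguments.
Unset Strict Implicit.
Unset Printing Implicit Defensive.

Import GRing.Theory.
Local Open Scope ring_scope.
Local Open Scope quotient_scope.

Section GeneratedIdeal.
Variables (R : comNzRingType) (G : R -> Prop).

Definition generated_ideal (p : R) : Prop :=
  exists s : seq (R * R),
    (forall q, q \in s -> G q.2) /\ p = \sum_(q <- s) q.1 * q.2.

Lemma generated_ideal0 : generated_ideal 0.
Proof. by exists [::]; rewrite big_nil. Qed.

Lemma generated_idealD p q :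
  generated_ideal p -> generated_ideal q -> generated_ideal (p + q).
Proof.
move=> [s [Gs ->]] [t [Gt ->]]; exists (s ++ t); rewrite big_cat; split=> // x.
by rewrite mem_cat => /orP[/Gs|/Gt].
Qed.

Lemma generated_idealM a p : generated_ideal p -> generated_ideal (a * p).
Proof.
move=> [s [Gs ->]]; exists [seq (a * q.1, q.2) | q <- s]; split.
  by move=> _ /mapP[q /Gs Gq ->].
by rewrite big_map mulr_sumr; apply: eq_bigr => q _; rewrite mulrA.
Qed.

End GeneratedIdeal.

Section Chow.
Variable d : nat.

Definition cube := 'rV['F_2]_d.

(* The coercion of 'F_2 to nat sends the two residues to 0 and 1. *)
Definition cube_le (u v : cube) : bool :=
  [forall i, (u ord0 i <= v ord0 i)%N].

Definition cube_comparable (u v : cube) : bool := cube_le u v || cube_le v u.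

Definition is_simplex (s : seq cube) : bool := all2rel cube_comparable s.

Definition cube_poly := {mpoly int[#|{: cube}|]}.

Definition Cvar (v : cube) : cube_poly := 'X_(enum_rank v).

Inductive GS_relation : cube_poly -> Prop :=
| GS_nonsimplex (s : seq cube) :
    ~~ is_simplex s -> GS_relation (\prod_(v <- s) Cvar v)
| GS_total (u : cube) :
    GS_relation (Cvar u * \sum_(v : cube) Cvar v)
| GS_facet (u w : cube) (i : 'I_d) :
    u ord0 i != w ord0 i ->
    GS_relation
      (Cvar u * Cvar w * \sum_(v : cube | v ord0 i == u ord0 i) Cvar v).

Definition GS_ideal : {pred cube_poly} :=
  fun p => `[< generated_ideal GS_relation p >].

(* Every relation has zero constant term, so the ideal is proper. *)
Lemma GS_relation_coef0 p : GS_relation p -> p.@[fun=> 0] = 0.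
Proof.
case=> [[|v s] // _|u|u w i _]; rewrite ?big_cons !mevalM mevalXU ?mul0r //.
Qed.

Lemma GS_ideal_closed : idealr_closed GS_ideal.
Proof.
split.
- exact/asboolP/generated_ideal0.
- apply/asboolP => -[s [Gs /(congr1 (meval (fun=> 0)))]].
  rewrite meval1 raddf_sum big_seq big1 => [/eqP|q /Gs Gq]; first by rewrite oner_eq0.
  by rewrite /= mevalM (GS_relation_coef0 Gq) mulr0.
move=> a p q /asboolP Ip /asboolP Iq; apply/asboolP.
exact/generated_idealD/Iq/generated_idealM.
Qed.

HB.instance Definition _ := isIdealr.Build cube_poly GS_ideal GS_ideal_closed.

Definition Chow_GS := {ideal_quot GS_ideal}.

HB.instance Definition _ := GRing.ComNzRing.on Chow_GS.

Lemma Chow_GS_eq0 (p : cube_poly) :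
  \pi_Chow_GS p = 0 <-> generated_ideal GS_relation p.
Proof.
rewrite -(raddf0 (\pi_Chow_GS : {additive cube_poly -> Chow_GS})).
split=> [/eqP|Ip].
  by rewrite -Quotient.idealrBE subr0 => /asboolP.
by apply/eqP; rewrite -Quotient.idealrBE subr0; apply/asboolP.
Qed.

Definition Cgen (v : cube) : Chow_GS := \pi_Chow_GS (Cvar v).

Definition pairing (v w : cube) : 'F_2 := \sum_(i < d) v ord0 i * w ord0 i.

(* The exponent is the representative in {0, 1} of the pairing. *)
Definition Fsum (w : cube) : Chow_GS :=
  \sum_(v : cube) (-1) ^+ pairing v w * Cgen v.

Definition alpha (w : cube) (P : {set {set 'I_d}}) : nat :=
  #|[set B in P | [exists j in B, w ord0 j == 1]]|.

End Chow.

(* Main.v *)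
(** Let [E] be a set of [e] coordinates, and let [D_y], for [y] in the cube on
    [E], be the sum of the [C_v] over the vertices [v] that restrict to [y].
    Every product of [C_u] with [e + 1] of the [D_y] vanishes.  Indeed, if [z]
    lies in a chain whose product is [X], combining (R2) with (R3) for the
    neighbours of [z] in the chain gives [X * sum_y D_y = 0], where the sum
    runs over [z] and over elements outside the chain.  So a repeated factor
    [D_z] can be traded for factors that lengthen the chain, and chains in the
    cube on [E] have at most [e + 1] elements.

    Since [sum_B (#|B| + 1) = d + k], the hypothesis provides a block [B] met
    by the supports of at most [#|B|] of the [w_i].  At least [d + 1 - #|B|]
    of the [F_{w_i}] are then combinations of the [D_y] for the complement [E]
    of [B], one more than its size. *)
Require Import Defs.
From mathcomp Require Import all_boot all_order all_algebra.
From mathcomp Require Import mpoly.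

Set Implicit Arguments.
Unset Strict Implicit.
Unset Printing Implicit Defensive.

Import GRing.Theory.
Local Open Scope ring_scope.

(** * Chains of finite sets *)

Section Chains.
Variable I : finType.

Definition chain (T : {set {set I}}) : Prop :=
  {in T &, forall y z : {set I}, (y \subset z) || (z \subset y)}.

Lemma chain_card_inj (T : {set {set I}}) :
  chain T -> {in T &, injective (fun y : {set I} => #|y|)}.
Proof.
move=> cT y z yT zT /= eq_yz; apply/eqP.
case/orP: (cT y z yT zT) => s; last rewrite eq_sym.
  by rewrite eqEcard s eq_yz /=.
by rewrite eqEcard s eq_yz /=.
Qed.

(** Cardinality is injective on a chain and takes at most [#|E|.+1] values on subsets of [E]. *)
Lemma chain_card (T : {set {set I}}) (E : {set I}) :
  chain T -> {in T, forall y : {set I}, y \subset E} -> (#|T| <= #|E|.+1)%N.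
Proof.
move=> cT sTE.
have inE y : y \in T -> (#|y| < #|E|.+1)%N by move=> /sTE /subset_leq_card.
pose f (y : {set I}) : 'I_(#|E|.+1) := inord #|y|.
have injf : {in T &, injective f}.
  move=> y z yT zT /(congr1 val) /=; rewrite !inordK ?inE //.
  by move=> h; apply: (chain_card_inj cT).
by rewrite -(card_in_imset injf) -[X in (_ <= X)%N]card_ord max_card.
Qed.

(** Take for [p] the largest member of [T] properly inside [z]: every other such member lies in [p],
    so any [i] in [z] but not in [p] works. The pair [z], [p] then feeds (R3) at [i]. *)
Lemma chain_below (T : {set {set I}}) (z : {set I}) :
  chain T -> (exists2 y, y \in T & y \proper z) ->
  exists i p, [/\ p \in T, i \in z, i \notin p
    & forall y, y \in T -> y \proper z -> i \notin y].
Proof.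
move=> cT [y0 y0T y0z].
have P0 : (y0 \in T) && (y0 \proper z) by rewrite y0T.
case: (@arg_maxnP _ y0 (fun y => (y \in T) && (y \proper z))
  (fun y => #|y|) P0) => p /andP[pT pz] maxp.
have /properP[_ [i iz ip]] := pz.
exists i, p; split=> // y yT yz; apply: contra ip.
case/orP: (cT y p yT pT) => [/subsetP|s]; first exact.
have /eqP <- // : p == y.
by rewrite eqEcard s; apply: maxp; rewrite yT.
Qed.

Lemma chain_above (T : {set {set I}}) (z : {set I}) :
  chain T -> (exists2 y, y \in T & z \proper y) ->
  exists i p, [/\ p \in T, i \notin z, i \in p
    & forall y, y \in T -> z \proper y -> i \in y].
Proof.
move=> cT [y0 y0T y0z].
have P0 : (y0 \in T) && (z \proper y0) by rewrite y0T.
case: (@arg_minnP _ y0 (fun y => (y \in T) && (z \proper y))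
  (fun y => #|y|) P0) => p /andP[pT pz] minp.
have /properP[_ [i ip iz]] := pz.
exists i, p; split=> // y yT yz.
case/orP: (cT p y pT yT) => [/subsetP|s]; first exact.
have /eqP -> // : y == p.
by rewrite eqEcard s; apply: minp; rewrite yT.
Qed.

End Chains.

(** * Annihilation along a chain *)

Section ChainSupport.
Variables (R : comNzRingType) (I : finType) (E : {set I}) (D : {set I} -> R).
Implicit Types (x : R) (y z w v : {set I}) (T : {set {set I}}).

Let total := \sum_(z : {set I}) D z.
Let facet i := \sum_(z : {set I} | i \in z) D z.

Hypothesis D_out : forall y : {set I}, ~~ (y \subset E) -> D y = 0.

Definition incomparable (y z : {set I}) := ~~ (y \subset z) && ~~ (z \subset y).

(** The clauses mirror (R1), (R2) and (R3) for a factor at [y]. Only the side of the cube containing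
    [i] is recorded; the opposite side is [total] minus [facet i]. *)
Definition local_at (x : R) (y : {set I}) : Prop :=
  [/\ forall z, incomparable y z -> x * D z = 0,
      x * total = 0
    & forall (w : {set I}) i, (i \in y) != (i \in w) -> x * D w * facet i = 0].

Hypothesis D_local : forall y, local_at (D y) y.

(** The model is a product of the [D y] over [T]. Keeping only annihilation properties lets a single
    [C_u] start the chain as well. *)
Definition supported (x : R) (T : {set {set I}}) : Prop :=
  [/\ {in T, forall y, y \subset E}, chain T, {in T, forall y, local_at x y}
    & forall (y w : {set I}) i, y \in T -> w \in T -> (i \in y) != (i \in w) ->
      x * facet i = 0].

Lemma local_atM x y a : local_at x y -> local_at (x * a) y.
Proof.
case=> h1 h2 h3; split=> [z /h1 h||w i /h3 h].
- by rewrite mulrAC h mul0r.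
- by rewrite mulrAC h2 mul0r.
- by rewrite -!mulrA (mulrC a) !mulrA h mul0r.
Qed.

Lemma local_at_sum (J : finType) (P : pred J) (f : J -> R) y :
  (forall j, P j -> local_at (f j) y) -> local_at (\sum_(j | P j) f j) y.
Proof.
move=> fy; split=> [z inc||w i iw]; rewrite !mulr_suml big1 // => j /fy[h1 h2 h3].
- exact: h1.
- exact: h2.
- exact: h3.
Qed.

Lemma supported_set1 x y :
  y \subset E -> local_at x y -> supported x [set y].
Proof.
move=> yE xy; split.
- by move=> z /set1P ->.
- by move=> u v /set1P -> /set1P ->; rewrite subxx.
- by move=> z /set1P ->.
- by move=> u v i /set1P -> /set1P ->; rewrite eqxx.
Qed.

Lemma supportedM x T z :
  supported x T -> z \subset E ->
  {in T, forall y, ~~ incomparable y z} -> supported (x * D z) (z |: T).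
Proof.
move=> [TE cT lT fT] zE cz.
have cz' y : y \in T -> (y \subset z) || (z \subset y).
  by move/cz; rewrite /incomparable negb_and !negbK.
split.
- by move=> y /setU1P[->|/TE].
- move=> y w /setU1P[->|yT] /setU1P[->|wT]; rewrite ?subxx ?cz' //.
    by rewrite orbC cz'.
  exact: cT.
- move=> y /setU1P[->|/lT]; last exact: local_atM.
  by rewrite mulrC; apply: local_atM.
- move=> y w i /setU1P[->|yT] /setU1P[->|wT]; rewrite ?eqxx //.
  + by rewrite eq_sym; case: (lT w wT) => _ _; apply.
  + by case: (lT y yT) => _ _; apply.
  + by move=> /(fT _ _ _ yT wT) h; rewrite mulrAC h mul0r.
Qed.

(** [c] is the side containing [z] of a coordinate that separates [z] from its predecessor in [T],
    or everything if there is no predecessor. *)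
Lemma supported_below x T z :
  supported x T -> z \in T ->
  exists c : pred {set I}, [/\ x * (\sum_(v | c v) D v) = 0, c z,
    forall y, y \in T -> y \proper z -> ~~ c y
  & forall v, ~~ c v -> ~~ (z \subset v)].
Proof.
move=> [TE cT lT fT] zT.
case: (pickP (fun y => (y \in T) && (y \proper z))) => [y0 /andP[y0T y0z]|no].
  have [|i [p [pT iz ip hi]]] := chain_below (z := z) cT; first by exists y0.
  exists (fun v : {set I} => i \in v); split=> //.
    by apply: (fT z p) => //; rewrite iz (negPf ip).
  by move=> v; apply: contra => /subsetP; apply.
exists predT; split=> //; first by case: (lT z zT).
by move=> y yT yz; have := no y; rewrite yT yz.
Qed.

Lemma supported_above x T z :
  supported x T -> z \in T ->
  exists c : pred {set I}, [/\ x * (\sum_(v | c v) D v) = 0, c z,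
    forall y, y \in T -> z \proper y -> ~~ c y
  & forall v, ~~ c v -> ~~ (v \subset z)].
Proof.
move=> [TE cT lT fT] zT; have [_ xt _] := lT z zT.
case: (pickP (fun y => (y \in T) && (z \proper y))) => [y0 /andP[y0T y0z]|no].
  have [|i [p [pT iz ip hi]]] := chain_above (z := z) cT; first by exists y0.
  exists (fun v : {set I} => i \notin v); split=> //.
  (* The side without [i] is obtained by subtracting [facet i] from [total]. *)
  - have fi : x * facet i = 0 by apply: (fT z p) => //; rewrite ip (negPf iz).
    move: xt; rewrite /total (bigID (fun v : {set I} => i \in v)) /= mulrDr.
    by rewrite -/(facet i) fi add0r.
  - by move=> y yT /(hi y yT); rewrite negbK.
  - by move=> v; rewrite negbK => iv; apply: contra iz => /subsetP; apply.
exists predT; split=> //.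
by move=> y yT yz; have := no y; rewrite yT yz.
Qed.

(** Intersect the sides given by the two neighbours of [z]. Since [x] kills the whole sum, each
    side, and the part outside both, it kills the intersection. *)
Lemma supported_link x T z :
  supported x T -> z \in T ->
  exists2 c : pred {set I}, x * (\sum_(v | c v) D v) = 0
    & forall y, y \in T -> c y = (y == z).
Proof.
move=> sx zT; have [_ cT lT _] := sx; have [xinc xt _] := lT z zT.
have [c1 [s1 c1z c1T c1n]] := supported_below sx zT.
have [c2 [s2 c2z c2T c2n]] := supported_above sx zT.
exists (fun v => c1 v && c2 v).
  (* A set outside both sides neither contains [z] nor lies in it. *)
  have nn : x * (\sum_(v | ~~ c1 v && ~~ c2 v) D v) = 0.
    rewrite mulr_sumr big1 // => v /andP[n1 n2]; apply: xinc.
    by rewrite /incomparable c1n // c2n.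
  have nc1 : x * (\sum_(v | ~~ c1 v) D v) = 0.
    by move: xt; rewrite /total (bigID c1) /= mulrDr s1 add0r.
  move: nc1; rewrite (bigID c2) /= mulrDr nn addr0 => n12.
  move: s2; rewrite (bigID c1) /= mulrDr.
  under [X in x * X + _]eq_bigl do rewrite andbC.
  under [X in _ + x * X]eq_bigl do rewrite andbC.
  by rewrite n12 addr0.
move=> y yT; have [->|nyz] := eqVneq y z; first by rewrite c1z c2z.
apply/negP => /andP[y1 y2].
have /orP[s|s] := cT y z yT zT.
  by move: (c1T y yT); rewrite y1 properEneq nyz s => /(_ isT).
by move: (c2T y yT); rewrite y2 properEneq eq_sym nyz s => /(_ isT).
Qed.

(* A factor [D z] with [z] outside [T] lengthens the chain; one with [z] in
   [T] can be traded, using [supported_link], for factors outside [T].  The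
   length of chains of subsets of [E] bounds the number of steps. *)
Lemma supported_prod_eq0 x T (fs : seq R) :
  supported x T ->
  {in fs, forall f, exists c : {set I} -> R, f = \sum_y c y * D y} ->
  (#|E|.+1 < #|T| + size fs)%N -> x * \prod_(f <- fs) f = 0.
Proof.
elim: fs x T => [|f fs IH] x T sx hfs hsz.
  move: hsz; rewrite addn0 ltnNge => /negP[].
  by have [TE cT _ _] := sx; apply: chain_card.
have hfs' : {in fs, forall f, exists c : {set I} -> R, f = \sum_y c y * D y}.
  by move=> g gfs; apply: hfs; rewrite inE gfs orbT.
have outT z : z \notin T -> x * D z * \prod_(f <- fs) f = 0.
  move=> zT; have [zE|/D_out ->] := boolP (z \subset E); last first.
    by rewrite mulr0 mul0r.
  have [TE cT lT fT] := sx.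
  case: (pickP (fun y => (y \in T) && incomparable y z)) => [y|no].
    by case/andP=> /lT[h _ _] /h ->; rewrite mul0r.
  apply: (IH _ (z |: T)) => //; last first.
    by rewrite cardsU1 zT add1n addSnnS.
  by apply: supportedM => // y yT; have := no y; rewrite yT /= => ->.
have all0 z : x * D z * \prod_(f <- fs) f = 0.
  have [zT|/outT //] := boolP (z \in T).
  have [c sc cT] := supported_link sx zT.
  move: sc; rewrite (bigD1 z) /= ?cT ?eqxx // mulrDr => /addr0_eq.
  move/(congr1 -%R); rewrite opprK => ->.
  rewrite mulNr mulr_sumr mulr_suml big1 ?oppr0 // => v /andP[cv vz].
  by apply: outT; apply: contra vz => vT; rewrite -(cT v vT).
have [c ->] := hfs f (mem_head _ _).
rewrite big_cons mulrA mulr_sumr mulr_suml big1 // => y _.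
by rewrite mulrCA -mulrA all0 mulr0.
Qed.

End ChainSupport.

(** * The Chow relations in terms of supports *)

Section ChowRelations.
Variable d : nat.
Implicit Types (u v w : cube d) (E : {set 'I_d}).

Lemma Chow_GS_relation_eq0 (p : cube_poly d) :
  GS_relation p -> \pi_(Chow_GS d)%qT p = 0.
Proof.
move=> Gp; apply/Chow_GS_eq0; exists [:: (1, p)].
by rewrite big_seq1 mul1r; split=> // q /[!inE] /eqP ->.
Qed.

Definition csupp v : {set 'I_d} := [set i | v ord0 i == 1].

Lemma F2_cases (a : 'F_2) : (a = 0) \/ (a = 1).
Proof.
case: a => [[|[|m]] //= lt_m]; [left|right]; exact: val_inj.
Qed.

Lemma cube_le_csupp u v : cube_le u v = (csupp u \subset csupp v).
Proof.
apply/forallP/subsetP => [le_uv i|sub i].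
  rewrite !inE => /eqP ui; have := le_uv i; rewrite ui.
  by case: (F2_cases (v ord0 i)) => ->.
have := sub i; rewrite !inE.
by case: (F2_cases (u ord0 i)) => ->; case: (F2_cases (v ord0 i)) => -> // /(_ isT).
Qed.

Lemma csupp_neq u w i :
  (u ord0 i != w ord0 i) = ((i \in csupp u) != (i \in csupp w)).
Proof.
rewrite !inE.
by case: (F2_cases (u ord0 i)) => ->; case: (F2_cases (w ord0 i)) => ->.
Qed.

Lemma Cgen_incomparable u v :
  incomparable (csupp u) (csupp v) -> Cgen u * Cgen v = 0.
Proof.
move=> inc; have := @GS_nonsimplex d [:: u; v].
rewrite !big_cons big_nil mulr1 => /(_ _)/Chow_GS_relation_eq0.
rewrite rmorphM; apply.
apply: contraL inc => /allrelP /(_ u v); rewrite !inE !eqxx orbT => /(_ isT isT).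
by rewrite /cube_comparable !cube_le_csupp /incomparable -negb_or negbK.
Qed.

Lemma Cgen_total u : Cgen u * \sum_v Cgen v = 0.
Proof.
have := Chow_GS_relation_eq0 (GS_total u).
by rewrite rmorphM rmorph_sum.
Qed.

Lemma Cgen_facet u w i :
  (i \in csupp u) != (i \in csupp w) ->
  Cgen u * Cgen w * \sum_(v | i \in csupp v) Cgen v = 0.
Proof.
(* (R3) sums over the side of its first vertex; exchanging [u] and [w] makes this the side with
   coordinate 1. *)
wlog iu : u w / i \in csupp u => [hw|] iuw.
  have [iu|iu] := boolP (i \in csupp u); first exact: hw.
  rewrite (mulrC (Cgen u)); apply: hw; last by rewrite eq_sym.
  by move: iuw; rewrite (negPf iu); case: (i \in csupp w).
have := iuw; rewrite -csupp_neq => /GS_facet/Chow_GS_relation_eq0.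
rewrite !rmorphM rmorph_sum /=; move: iu; rewrite inE => /eqP ->.
by under [in X in _ -> X]eq_bigl => v do rewrite inE.
Qed.

End ChowRelations.

(** * Projection to the coordinates in [E] *)

Section Restriction.
Variables (d : nat) (E : {set 'I_d}).
Implicit Types (u v w : cube d) (y : {set 'I_d}).

(* The pullback of the generator [C_y] under the projection of cubes that
   forgets the coordinates outside [E]. *)
Definition Dgen (y : {set 'I_d}) : Chow_GS d :=
  \sum_(v | csupp v :&: E == y) Cgen v.

Lemma sum_Dgen (c : pred {set 'I_d}) :
  \sum_(y | c y) Dgen y = \sum_(v | c (csupp v :&: E)) Cgen v.
Proof.
rewrite (partition_big (fun v => csupp v :&: E) c) //=.
apply: eq_bigr => y cy; apply: eq_bigl => v.
by case: eqVneq => [->|]; rewrite ?cy ?andbF.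
Qed.

Lemma Dgen_out y : ~~ (y \subset E) -> Dgen y = 0.
Proof.
by move=> yE; apply: big_pred0 => v; apply: contraNF yE => /eqP <-; apply: subsetIr.
Qed.

Lemma Cgen_local u : local_at Dgen (Cgen u) (csupp u :&: E).
Proof.
split=> [z inc||w i iuw].
- rewrite mulr_sumr big1 // => v /eqP vz; apply: Cgen_incomparable.
  move: inc; rewrite -vz /incomparable => /andP[n1 n2].
  by apply/andP; split; [apply: contra n1|apply: contra n2]; apply: setSI.
- by rewrite sum_Dgen Cgen_total.
- rewrite sum_Dgen; have [iE|iE] := boolP (i \in E); last first.
    by rewrite big_pred0 ?mulr0 // => v; rewrite inE (negPf iE) andbF.
  rewrite /Dgen (mulr_sumr _ _ _ (Cgen u)) mulr_suml big1 // => v /eqP vw.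
  under eq_bigl => a do rewrite inE iE andbT.
  apply: Cgen_facet.
  by move: iuw; rewrite -vw !(inE, in_setI) iE !andbT.
Qed.

Lemma Dgen_local y : local_at Dgen (Dgen y) y.
Proof.
by apply: local_at_sum => v /eqP <-; apply: Cgen_local.
Qed.

Lemma Fsum_Dgen w :
  csupp w \subset E -> exists c, Fsum w = \sum_y c y * Dgen y.
Proof.
move=> wE.
(* The sign depends only on the coordinates of [v] in [E], so it can be read off the vertex with
   support [y]. *)
exists (fun y => (-1) ^+ pairing (\row_i (i \in y)%:R) w).
rewrite /Fsum (partition_big (fun v => csupp v :&: E) predT) //=.
apply: eq_bigr => y _; rewrite mulr_sumr; apply: eq_bigr => v /eqP vy.
congr (_ ^+ _ * _); congr (nat_of_ord _); apply: eq_bigr => i _.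
rewrite mxE -vy !inE; case: (F2_cases (w ord0 i)) => wi; rewrite wi ?mulr0 //.
have -> : i \in E by move/subsetP: wE; apply; rewrite inE wi.
by rewrite andbT; case: (F2_cases (v ord0 i)) => ->.
Qed.

(* Geometrically: [#|E| + 1] vertical divisors pulled back from a product of
   [#|E|] curves meet in vertical fibres, on which every vertical divisor
   restricts to zero. *)
Lemma Cgen_prod_Fsum_eq0 u (ws : seq (cube d)) :
  {in ws, forall w : cube d, csupp w \subset E} -> (#|E| < size ws)%N ->
  Cgen u * \prod_(w <- ws) Fsum w = 0.
Proof.
move=> wsE szws; rewrite -(big_map (@Fsum d) xpredT id).
apply: (supported_prod_eq0 Dgen_out Dgen_local
  (supported_set1 (subsetIr (csupp u) E) (Cgen_local u))).
  by move=> _ /mapP[w /wsE wE ->]; apply: Fsum_Dgen.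
by rewrite cards1 size_map.
Qed.

End Restriction.

(** * Counting over the blocks *)

Lemma alphaE d (w : cube d) (P : {set {set 'I_d}}) :
  alpha w P = (\sum_(B in P) ~~ [disjoint csupp w & B])%N.
Proof.
have meets B : [exists j in B, w ord0 j == 1] = ~~ [disjoint csupp w & B].
  apply/exists_inP/pred0Pn => -[j].
    by move=> jB wj; exists j; rewrite /= inE wj.
  by rewrite /= inE => /andP[wj jB]; exists j.
rewrite /alpha -sum1_card; under eq_bigl do rewrite inE meets.
by rewrite big_mkcondr; apply: eq_bigr => B _; case: [disjoint _ & _].
Qed.

Theorem theorem1p8 (d : nat) (hd : (1 <= d)%N)
  (w : 'I_d.+1 -> cube d)
  (k : nat) (P : {set {set 'I_d}})
  (hP : partition P [set: 'I_d]) (hk : #|P| = k)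
  (hlt : (\sum_(i < d.+1) alpha (w i) P < d + k)%N) :
  \prod_(i < d.+1) Fsum (w i) = 0 :> Chow_GS d.
Proof.
(* Double counting of the pairs of an index [i] and a block met by the support of [w i]. *)
have sumB : (\sum_(B in P) #|[set i | ~~ [disjoint csupp (w i) & B]]|
             < \sum_(B in P) #|B|.+1)%N.
  under [X in (_ < X)%N]eq_bigr do rewrite -addn1.
  rewrite big_split /= -(card_partition hP) sum1_card cardsT card_ord hk.
  apply: leq_ltn_trans hlt; under [X in (_ <= X)%N]eq_bigr do rewrite alphaE.
  rewrite exchange_big /=; apply: leq_sum => B _.
  by rewrite -sum1dep_card big_mkcond /=; apply: leq_sum => i _; case: ifP.
have /exists_inP[B BP ltB] : [exists B in P,
    (#|[set i | ~~ [disjoint csupp (w i) & B]]| < #|B|.+1)%N].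
  apply: contraLR sumB => /exists_inPn h; rewrite -leqNgt.
  by apply: leq_sum => B /h; rewrite -leqNgt.
have B0 : (0 < #|B|)%N.
  by rewrite card_gt0; case/and3P: hP => _ _; apply: contraNneq => <-.
pose L := [set i | [disjoint csupp (w i) & B]].
have cardL : (#|~: B| < #|L|)%N.
  have := cardsC L; have := cardsC B; rewrite !card_ord.
  have -> : ~: L = [set i | ~~ [disjoint csupp (w i) & B]].
    by apply/setP => i; rewrite !inE.
  move: ltB; move: #|~: B| #|L| #|B| #|[set i | _]| => e l b a ab cB cL.
  by rewrite -(ltn_add2r a) cL -cB addnC ltnS leq_add2r.
(* The factor at [l0] is set aside to supply [C_u]. It is taken outside [L] if possible; otherwise
   [L] has [d + 1] elements, and losing one is harmless because [B] is non-empty. *)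
have [l0 cardL0] : exists l0, (#|~: B| < #|L :\ l0|)%N.
  have [|/subsetPn[l0 _ l0L]] := boolP ([set: 'I_d.+1] \subset L).
    rewrite subTset => /eqP LT; exists ord0; rewrite LT.
    have := cardsD1 ord0 [set: 'I_d.+1]; rewrite inE cardsT card_ord add1n => -[<-].
    have := cardsC B; rewrite card_ord; move: #|~: B| #|B| B0 => e b b0 <-.
    by rewrite -[X in (X < _)%N]add0n ltn_add2r.
  exists l0; have := cardsD1 l0 L.
  by rewrite (negPf l0L) add0n => <-.
rewrite (bigD1 l0) //= (bigID (mem L)) /= mulrA.
rewrite {1}/Fsum mulr_suml [X in X * _](_ : _ = 0) ?mul0r //.
apply: big1 => u _; rewrite -mulrA.
rewrite (eq_bigl (fun i => i \in L :\ l0)) => [|i]; last by rewrite in_setD1.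
have := @Cgen_prod_Fsum_eq0 d (~: B) u [seq w i | i <- enum (L :\ l0)].
rewrite big_map big_enum /= size_map -cardE => ->; rewrite ?mulr0 //.
move=> _ /mapP[i iL ->]; move: iL; rewrite mem_enum !inE => /andP[_ dis].
by rewrite -disjoints_subset.
Qed.
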